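(* Let $X$ be a one-sided shift space. The following conditions are equivalent: (i) $X$ contains no eventually periodic points; (ii) $\widetilde X$ contains no eventually periodic points; (iii) the groupoid $\mathcal G_X$ is principal.
   Context: **Shift spaces.** $\mathbb N=\{0,1,2,\dots\}$. A one-sided shift space is a closed subset $X\subseteq\mathfrak A^{\mathbb N}$ ($\mathfrak A$ a finite discrete alphabet, product topology) with $\sigma(X)\subseteq X$ (equality not assumed), where $\sigma(x)_n=x_{n+1}$; put $\sigma_X=\sigma|_X$. Write $x_{[i,j)}=x_i\cdots x_{j-1}$, and let $P_l(x)$ be the set of words $\mu$ of length $l$ over $\mathfrak A$ with $\mu x\in X$. A point $x\in X$ is periodic if $\sigma_X^p(x)=x$ for some $p\ge1$, and eventually periodic if $\sigma_X^n(x)$ is periodic for some $n\in\mathbb N$; similarly for $\widetilde X$ with $\sigma_{\widetilde X}$. **Cover.** Let $\mathcal I=\{(k,l)\in\mathbb N\times\mathbb N: k\le l\}$ with $(k_1,l_1)\preceq(k_2,l_2)$ iff $k_1\le k_2$ and $l_1-k_1\le l_2-k_2$. For $(k,l)\in\mathcal I$ let $x\overset{k,l}{\sim}x'$ iff $x_{[0,k)}=x'_{[0,k)}$ and $\bigcup_{l'\le l}P_{l'}(\sigma_X^k(x))=\bigcup_{l'\le l}P_{l'}(\sigma_X^k(x'))$; let ${}_k[x]_l$ be the class of $x$ and ${}_kX_l$ the (finite, discrete) set of classes. If $(k_1,l_1)\preceq(k_2,l_2)$ then ${}_{k_2}[x]_{l_2}\mapsto{}_{k_1}[x]_{l_1}$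 is well defined, and the cover $\widetilde X$ is the projective limit of the ${}_kX_l$ along these maps, a compact Hausdorff space. The map $\sigma_{\widetilde X}\colon\widetilde X\to\widetilde X$ is defined by: the $(k,l)$-coordinate of $\sigma_{\widetilde X}(\tilde x)$ is ${}_k[\sigma_X(y)]_l$ for any representative $y$ of the $(k+1,l+1)$-coordinate of $\tilde x$ (for $k<l$ one may use the $(k+1,l)$-coordinate); it is a local homeomorphism. **Groupoid.** $\mathcal G_X=\{(\tilde x,p,\tilde y)\in\widetilde X\times\mathbb Z\times\widetilde X:\exists i,j\in\mathbb N,\ p=i-j,\ \sigma_{\widetilde X}^i(\tilde x)=\sigma_{\widetilde X}^j(\tilde y)\}$ with product $(\tilde x,p,\tilde y)(\tilde y,q,\tilde z)=(\tilde x,p+q,\tilde z)$ and inverse $(\tilde y,-p,\tilde x)$; its units are the elements $(\tilde x,0,\tilde x)$. It is principal if its isotropy $\{(\tilde x,p,\tilde x)\in\mathcal G_X\}$ consists of units only. *)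

(* Defs.v *)
From HB Require Import structures.
From mathcomp Require Import all_boot all_order all_algebra.
From mathcomp Require Import generic_quotient.
From mathcomp Require Import all_classical.
From mathcomp Require Import topology zify.

Set Implicit Arguments.
Unset Strict Implicit.
Unset Printing Implicit Defensive.

Local Open Scope classical_set_scope.
Local Open Scope quotient_scope.

Definition periodic_point (T : Type) (f : T -> T) (x : T) : Prop :=
  exists p : nat, (1 <= p)%N /\ iter p f x = x.

Definition eventually_periodic_point (T : Type) (f : T -> T) (x : T) : Prop :=
  exists n : nat, periodic_point f (iter n f x).

Definition full_shift (A : finType) :=
  prod_topology (fun _ : nat => discrete_topology A).

Definition shift_map {A : finType} (x : full_shift A) : full_shift A :=
  fun n => x n.+1.

Record shift_space (A : finType) := ShiftSpace {
  shift_points :> set (full_shift A);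
  points_closed : closed shift_points;
  points_shift : shift_map @` shift_points `<=` shift_points
}.

(* The word [mu] followed by [x]; [x (n - size mu)] is the default value that
   [nth] returns when [n] is past the end of [mu]. *)
Definition prepend (A : finType) (mu : seq A) (x : full_shift A) :
  full_shift A := fun n => nth (x (n - size mu)%N) mu n.

Section Shift.
Variables (A : finType) (X : shift_space A).

Lemma sigma_subproof (x : X) : shift_map (val x) \in (X : set (full_shift A)).
Proof.
by apply/mem_set/points_shift; exists (val x) => //; exact: set_mem (valP x).
Qed.

Definition sigma (x : X) : X := exist _ (shift_map (val x)) (sigma_subproof x).

Definition predecessors (l : nat) (x : X) : set (seq A) :=
  [set mu | size mu = l /\ (X : set (full_shift A)) (prepend mu (val x))].

Definition predecessors_upto (l : nat) (x : X) : set (seq A) :=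
  \bigcup_(l' in [set l' | (l' <= l)%N]) predecessors l' x.

Definition cover_index : Type := {kl : nat * nat | (kl.1 <= kl.2)%N}.

(* Truncated subtraction is harmless: [k <= l] for every index. *)
Definition index_le (i j : cover_index) : bool :=
  ((val i).1 <= (val j).1)%N &&
  ((val i).2 - (val i).1 <= (val j).2 - (val j).1)%N.

Definition index_succ (i : cover_index) : cover_index :=
  exist (fun kl : nat * nat => (kl.1 <= kl.2)%N)
    ((val i).1.+1, (val i).2.+1) (valP i).

Definition cover_rel (i : cover_index) : rel X := fun x x' =>
  `[< mkseq (val x) (val i).1 = mkseq (val x') (val i).1 /\
      predecessors_upto (val i).2 (iter (val i).1 sigma x) =
      predecessors_upto (val i).2 (iter (val i).1 sigma x') >].

Lemma cover_relP (i : cover_index) (x x' : X) :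
  reflect (mkseq (val x) (val i).1 = mkseq (val x') (val i).1 /\
      predecessors_upto (val i).2 (iter (val i).1 sigma x) =
      predecessors_upto (val i).2 (iter (val i).1 sigma x'))
    (cover_rel i x x').
Proof. exact: asboolP. Qed.

Lemma cover_rel_refl i : reflexive (cover_rel i).
Proof. by move=> x; apply/cover_relP. Qed.

Lemma cover_rel_sym i : symmetric (cover_rel i).
Proof.
by move=> x y; apply/cover_relP/cover_relP => -[e1 e2]; rewrite e1 e2.
Qed.

Lemma cover_rel_trans i : transitive (cover_rel i).
Proof.
move=> y x z /cover_relP[e1 e2] /cover_relP[e3 e4].
by apply/cover_relP; rewrite e1 e2.
Qed.

Canonical cover_equiv i :=
  EquivRel (cover_rel i) (cover_rel_refl i) (cover_rel_sym i)
    (@cover_rel_trans i).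

Definition cover_level (i : cover_index) : Type := {eq_quot (cover_rel i)}.

HB.instance Definition _ i := Choice.on (cover_level i).
HB.instance Definition _ i := EqQuotient.on (cover_level i).
HB.instance Definition _ i :=
  Topological.copy (cover_level i) (discrete_topology (cover_level i)).

Definition level_class (i : cover_index) (x : X) : cover_level i := \pi x.

Lemma level_classP (i : cover_index) (x x' : X) :
  level_class i x = level_class i x' <-> cover_rel i x x'.
Proof. by split=> [/eqquotP|?]; last apply/eqquotP. Qed.

(* Only meant for [index_le i j]; the choice of a representative is then
   irrelevant by [cover_bondE]. *)
Definition cover_bond (j i : cover_index) (c : cover_level j) : cover_level i :=
  level_class i (repr c).

Definition level_prod :=
  prod_topology (fun i => cover_level i : topologicalType).

Definition cover_space : set level_prod :=
  [set t | forall i j, index_le i j -> cover_bond i (t j) = t i].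

Definition shift_cover : Type := set_type cover_space.

HB.instance Definition _ := Topological.copy shift_cover (set_type cover_space).

Lemma predecessors_uptoE l (x : X) mu : predecessors_upto l x mu <->
  (size mu <= l)%N /\ (X : set (full_shift A)) (prepend mu (val x)).
Proof.
split=> [[l' /= le_l' [sz Xmu]]|[le_mu Xmu]]; first by rewrite sz.
by exists (size mu).
Qed.

Lemma iter_sigmaE k (x : X) n : val (iter k sigma x) n = val x (n + k)%N.
Proof. by elim: k n => [|k IH] n; rewrite ?addn0 //= /shift_map IH addSnnS. Qed.

Lemma prepend_iter_sigma mu d (y : X) :
  prepend mu (val y) = prepend (mu ++ mkseq (val y) d) (val (iter d sigma y)).
Proof.
apply/funext => n; rewrite /prepend nth_cat size_cat size_mkseq.
case: ltnP => [lt_n|le_n]; first exact: set_nth_default.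
rewrite nth_default //; case: (ltnP (n - size mu)%N d) => [lt_d|le_d].
  by rewrite nth_mkseq.
by rewrite nth_default ?size_mkseq // iter_sigmaE subnDA subnK.
Qed.

Lemma cover_rel_le i j x x' :
  index_le i j -> cover_rel j x x' -> cover_rel i x x'.
Proof.
case: i j => -[k1 l1] /= le1 [[k2 l2] /= le2] /andP[/= le_k le_d].
move=> /cover_relP[/= eqw eqP]; apply/cover_relP => /=.
have eqx n : (n < k2)%N -> val x n = val x' n.
  move=> lt_n; have := congr1 (fun s => nth (val x n) s n) eqw.
  by rewrite !nth_mkseq.
split.
  apply/eq_in_map => n; rewrite mem_iota add0n => /= lt_n.
  by apply: eqx; apply: leq_trans le_k.
have eqc : mkseq (val (iter k1 sigma x)) (k2 - k1) =
           mkseq (val (iter k1 sigma x')) (k2 - k1).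
  apply/eq_in_map => n; rewrite mem_iota add0n /= => lt_n.
  by rewrite !iter_sigmaE; apply: eqx; lia.
have key (y : X) mu : predecessors_upto l1 (iter k1 sigma y) mu <->
    (size mu <= l1)%N /\ predecessors_upto l2 (iter k2 sigma y)
      (mu ++ mkseq (val (iter k1 sigma y)) (k2 - k1)).
  have e : iter k2 sigma y = iter (k2 - k1) sigma (iter k1 sigma y).
    by rewrite -iterD subnK.
  rewrite !predecessors_uptoE e -prepend_iter_sigma size_cat size_mkseq.
  by split=> [[le_mu Xmu]|[le_mu [_ Xmu]]]; split=> //; split=> //; lia.
by apply/seteqP; split=> mu /key[le_mu H]; apply/key; split=> //;
  [rewrite -eqc -eqP | rewrite eqc eqP].
Qed.

Lemma cover_bondE i j x : index_le i j ->
  cover_bond i (level_class j x) = level_class i x.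
Proof.
move=> le_ij; apply/level_classP; apply: (cover_rel_le le_ij).
by apply/level_classP; rewrite /level_class reprK.
Qed.

Lemma cover_rel_sigma i x x' :
  cover_rel (index_succ i) x x' -> cover_rel i (sigma x) (sigma x').
Proof.
case: i => -[k l] /= le_kl /cover_relP[/= eqw eqP].
apply/cover_relP => /=; split.
  have /= := congr1 behead eqw.
  by rewrite /mkseq (iotaDl 1 0) -!map_comp.
rewrite -!iterSr.
by apply/seteqP; split=> mu /predecessors_uptoE[le_mu Xmu];
  apply/predecessors_uptoE; split=> //;
  apply: (proj2 ((predecessors_uptoE l.+1 _ mu).1 _));
  [rewrite -eqP | rewrite eqP]; apply/predecessors_uptoE; split=> //;
  exact: leqW.
Qed.

Definition sigma_cover_fun (t : shift_cover) : level_prod :=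
  fun i => level_class i (sigma (repr (val t (index_succ i)))).

Lemma sigma_cover_subproof (t : shift_cover) :
  sigma_cover_fun t \in cover_space.
Proof.
apply/mem_set => i j le_ij; rewrite /sigma_cover_fun cover_bondE //.
apply/level_classP/cover_rel_sigma/level_classP.
have le_s : index_le (index_succ i) (index_succ j).
  by move: le_ij; rewrite /index_le /= !subSS ltnS.
have := set_mem (valP t) _ _ le_s; rewrite /cover_bond => ->.
by rewrite /level_class reprK.
Qed.

Definition sigma_cover (t : shift_cover) : shift_cover :=
  exist _ (sigma_cover_fun t) (sigma_cover_subproof t).

Lemma sigma_coverE (t : shift_cover) i (y : X) :
  val t (index_succ i) = level_class (index_succ i) y ->
  val (sigma_cover t) i = level_class i (sigma y).
Proof.
move=> ty; apply/level_classP/cover_rel_sigma/level_classP.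
by rewrite ty /level_class reprK.
Qed.

End Shift.

Arguments sigma {A} X x.
Arguments sigma_cover {A} X t.

Section Groupoid.
Variables (T : Type) (f : T -> T).
Local Open Scope ring_scope.

Definition orbit_groupoid : set (T * int * T) :=
  [set g | exists i j : nat,
     g.1.2 = i%:Z - j%:Z /\ iter i f g.1.1 = iter j f g.2].

(* Only meant for [g.2 = h.1.1]. *)
Definition groupoid_mul (g h : T * int * T) : T * int * T :=
  (g.1.1, g.1.2 + h.1.2, h.2).

Definition groupoid_inv (g : T * int * T) : T * int * T :=
  (g.2, - g.1.2, g.1.1).

Definition groupoid_units : set (T * int * T) :=
  [set g | exists x, g = (x, 0, x)].

Definition groupoid_isotropy (G : set (T * int * T)) : set (T * int * T) :=
  G `&` [set g | exists x p, g = (x, p, x)].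

Definition principal_groupoid (G : set (T * int * T)) : Prop :=
  groupoid_isotropy G `<=` groupoid_units.

Lemma groupoidM g h : orbit_groupoid g -> orbit_groupoid h -> g.2 = h.1.1 ->
  orbit_groupoid (groupoid_mul g h).
Proof.
case: g h => [[x p] y] [[y' q] z] [i [j /= [-> e1]]] [i' [j' /= [-> e2]]] ey.
exists (i' + i)%N, (j + j')%N; split=> /=; first by lia.
by rewrite !iterD e1 -e2 -!iterD addnC -ey.
Qed.

Lemma groupoidV g : orbit_groupoid g -> orbit_groupoid (groupoid_inv g).
Proof.
case: g => [[x p] y] [i [j /= [-> e]]].
by exists j, i; split=> //=; lia.
Qed.

Lemma groupoid_units_sub : groupoid_units `<=` orbit_groupoid.
Proof. by move=> g [x ->]; exists 0%N, 0%N; split. Qed.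

End Groupoid.

Definition cover_groupoid (A : finType) (X : shift_space A) :
  set (shift_cover X * int * shift_cover X) := orbit_groupoid (sigma_cover X).

Arguments cover_groupoid {A} X.

(* Main.v *)
Require Import Defs.
From mathcomp Require Import all_boot all_classical.
From mathcomp Require Import all_algebra topology zify.

Set Implicit Arguments.
Unset Strict Implicit.
Unset Printing Implicit Defensive.

Local Open Scope classical_set_scope.

(** Every shift space [X] is linked to its cover by two maps that intertwine
    the shifts. A point [x] of [X] defines the coherent family of its own
    classes, [cover_of_point x]; in the other direction a coherent family [t]
    determines an infinite word [base_word t], because its coordinate at [(k, k)]
    fixes the first [k] letters. The prefixes of that word are prefixes of points
    of [X], so it lies in [X] since [X] is closed, giving [base_point t]. A map
    that intertwines two transformations carries eventually periodic points to
    eventually periodic points ([semiconj_eventually_periodic]), so [X] has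
    such points exactly when its cover does.

    Principality of the groupoid concerns only the transformation of its unit
    space. A non-unit isotropy element [(x, i - j, x)] amounts to a coincidence
    of the [i]-th and [j]-th iterates of [x] with [i != j], which is eventual
    periodicity of [x] ([principal_orbit_groupoidP]). *)

(** Two times at which the orbit of [x] meets itself carry the same information
    as a preperiod and a period, but this form needs no bookkeeping when mapped
    along a semiconjugacy, and it matches the equation that defines the
    groupoid. *)
Lemma eventually_periodicP (T : Type) (f : T -> T) x :
  eventually_periodic_point f x <->
  exists i j, (i < j)%N /\ iter i f x = iter j f x.
Proof.
split=> [[n [p [p_gt0 e]]] | [i [j [lt_ij e]]]].
  by exists n, (p + n)%N; rewrite iterD e; split=> //; lia.
exists i, (j - i)%N; split; first by lia.
by rewrite -iterD subnK // ltnW.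
Qed.

Lemma semiconj_iter (S T : Type) (f : S -> S) (g : T -> T) (h : S -> T) :
  {morph h : x / f x >-> g x} ->
  forall n, {morph h : x / iter n f x >-> iter n g x}.
Proof. by move=> hfg; elim=> //= n IH x; rewrite hfg IH. Qed.

Lemma semiconj_eventually_periodic (S T : Type) (f : S -> S) (g : T -> T)
    (h : S -> T) x : {morph h : x / f x >-> g x} ->
  eventually_periodic_point f x -> eventually_periodic_point g (h x).
Proof.
move=> hfg /eventually_periodicP[i [j [lt_ij e]]].
apply/eventually_periodicP; exists i, j; split=> //.
by rewrite -!(semiconj_iter hfg) e.
Qed.

Lemma principal_orbit_groupoidP (T : Type) (f : T -> T) :
  principal_groupoid (orbit_groupoid f) <->
  ~ exists x, eventually_periodic_point f x.
Proof.
split=> [prG [x /eventually_periodicP[i [j [lt_ij e]]]] | aper].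
  (* Were the isotropy element [(x, i - j, x)] a unit, [i - j] would be [0]. *)
  have [|y [_]] := prG (x, i%:Z - j%:Z, x)%R; last by lia.
  by split; [exists i, j | exists x, (i%:Z - j%:Z)%R].
move=> g [[i [j [/= + +]]] [x [p eg]]]; rewrite {g}eg /= => -> e.
have [eij|neq_ij] := eqVneq i j; first by exists x; rewrite eij GRing.subrr.
case: aper; exists x; apply/eventually_periodicP.
by case: (ltngtP i j) neq_ij => // lt_ij _; [exists i, j | exists j, i].
Qed.

(** Basic neighbourhoods in the product of discrete spaces constrain finitely
    many letters, so points of [X] sharing longer and longer prefixes with [w]
    converge to [w]. *)
Lemma closed_prefixes (A : finType) (X : set (full_shift A)) (w : full_shift A) :
  closed X ->
  (forall k, exists y, X y /\ forall n, (n < k)%N -> w n = y n) -> X w.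
Proof.
move=> clX /choice[y yP].
have yX : \forall k \near \oo, X (y k).
  by apply: nearW => k; case: (yP k).
have yw : y @ \oo --> w; last exact: (@closed_cvg _ _ _ _ y X clX yX w yw).
apply: (iffRL (@cvg_sup _ _ _ _ _ _)) => n U [B [[C oC <-] Cw] sBU].
exists n.+1 => // k /= lt_nk; apply: sBU; rewrite /= /preimage /=.
by move: Cw; rewrite /preimage /= /proj ((yP k).2 n lt_nk).
Qed.

Section CoverMaps.
Variables (A : finType) (X : shift_space A).
Implicit Types (x y : X) (t : shift_cover X) (i j : cover_index).

Definition point_classes x : level_prod X := fun i => level_class i x.

Lemma cover_of_point_subproof x : point_classes x \in @cover_space A X.
Proof. by apply/mem_set => i j; apply: cover_bondE. Qed.

Definition cover_of_point x : shift_cover X :=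
  exist _ (point_classes x) (cover_of_point_subproof x).

Lemma cover_of_point_sigma :
  {morph cover_of_point : x / sigma X x >-> sigma_cover X x}.
Proof.
move=> x; apply/val_inj/functional_extensionality_dep => i.
by rewrite (@sigma_coverE _ _ _ i x).
Qed.

(** The indices [(k, k)] form a chain in [cover_index], so all the prefixes they
    determine belong to one word. *)
Definition diag (k : nat) : cover_index := exist _ (k, k) (leqnn k).

Lemma level_class_repr t i : level_class i (repr (val t i)) = val t i.
Proof. by rewrite /level_class reprK. Qed.

Lemma cover_class_le t i j y :
  index_le i j -> val t j = level_class j y -> val t i = level_class i y.
Proof.
by move=> le_ij tj; rewrite -(set_mem (valP t) i j le_ij) tj cover_bondE.
Qed.

(** The letter [n] lies outside the prefix of length [n] recorded at [(n, n)];
    [(n + 1, n + 1)] is the first diagonal index whose prefix contains it. *)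
Definition base_word t : full_shift A :=
  fun n => val (repr (val t (diag n.+1))) n.

(** Any representative of the coordinate at [(k, k)] shows the first [k] letters.
    This freedom gives both the membership of [base_word t] in [X] and the
    intertwining with the shift, where the representative of a coordinate of
    [sigma_cover X t] is a shifted one. *)
Lemma base_wordE t k y n :
  val t (diag k) = level_class (diag k) y -> (n < k)%N ->
  base_word t n = val y n.
Proof.
move=> ty lt_nk.
have le_nk : index_le (diag n.+1) (diag k) by rewrite /index_le /= !subnn lt_nk.
have := cover_class_le le_nk ty.
rewrite -{1}level_class_repr => /level_classP/cover_relP[/= eqw _].
have := congr1 (fun s => nth (val y n) s n) eqw.
by rewrite !nth_mkseq.
Qed.

Lemma base_point_subproof t : base_word t \in (X : set (full_shift A)).
Proof.
apply/mem_set; apply: closed_prefixes; first exact: (@points_closed _ X).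
move=> k; exists (val (repr (val t (diag k)))); split.
  exact: set_mem (valP _).
by move=> n; apply: base_wordE; rewrite level_class_repr.
Qed.

Definition base_point t : X := exist _ (base_word t) (base_point_subproof t).

Lemma base_point_sigma :
  {morph base_point : t / sigma_cover X t >-> sigma X t}.
Proof.
move=> t; apply/val_inj/funext => n /=; set y := repr (val t (diag n.+2)).
have ty : val t (index_succ (diag n.+1)) =
    level_class (index_succ (diag n.+1)) y.
  by rewrite (_ : index_succ _ = diag n.+2) ?level_class_repr //; apply: val_inj.
by rewrite (base_wordE (sigma_coverE ty)).
Qed.

End CoverMaps.

Theorem proposition2p9 (A : finType) (X : shift_space A) :
  ((~ exists x : X, eventually_periodic_point (sigma X) x) <->
   (~ exists t : shift_cover X, eventually_periodic_point (sigma_cover X) t)) /\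
  ((~ exists t : shift_cover X, eventually_periodic_point (sigma_cover X) t) <->
   principal_groupoid (cover_groupoid X)).
Proof.
split; last by apply: iff_sym; exact: principal_orbit_groupoidP.
split=> [aper [t per_t] | aper [x per_x]]; apply: aper.
  exists (base_point t).
  exact: semiconj_eventually_periodic (@base_point_sigma A X) per_t.
exists (cover_of_point x).
exact: semiconj_eventually_periodic (@cover_of_point_sigma A X) per_x.
Qed.
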